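(* Let $(\mathbb{C}_n, n\in\mathbb{Z})$ be a filtration of partitions of $\Omega$ with regularity constant $N_0$, let $\gamma,\beta\in(0,1]$, let $w$ be a weight of $\beta$-type with constant $N_{w,\beta}$, and let $\chi(dx)=w\,\mu(dx)$. Take $m\in\mathbb{Z}$ and let $u\in L_{1,\mathrm{loc}}(\Omega)$ be such that $|u|_{|n}\to 0$ on $\Omega$ as $n\to-\infty$. Then for any $p>\gamma\beta$, $$ \int_{\Omega}|u|^{p}\,\chi(dx)\leq N I^{(p-\gamma\beta)/p}J^{\gamma\beta/p}, $$ where $$ I=\int_{\Omega}|\mathcal{M}u|^{p}\,\chi(dx),\qquad J=\int_{\Omega}\Big(u^{\#}_{\gamma,m}+\big(\mathcal{M}_{m}(|u|^{\gamma})\big)^{1/\gamma}\Big)^{p}\,\chi(dx), $$ and the constant $N$ depends only on $N_0$, $N_{w,\beta}$, $p$, $\beta$, and $\gamma$.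
   Context: $(\Omega,\mathcal{F},\mu)$ is a complete measure space with $\sigma$-finite measure $\mu$, $\mu(\Omega)=\infty$; $|A|:=\mu(A)$; $\mathcal{F}^0$ is the family of $A\in\mathcal{F}$ with $\mu(A)<\infty$; $\mathbb{L}$ is a fixed dense subset of $L_1(\Omega)$; $f\in L_{1,\mathrm{loc}}(\Omega)$ means $fI_A\in L_1(\Omega)$ for every $A\in\mathcal{F}^0$. For $A\in\mathcal F^0$, the average of $f$ over $A$ is $f_A=⨍_A f\,d\mu:=|A|^{-1}\int_A f\,d\mu$, with $0/0:=0$. Filtration of partitions: a sequence $(\mathbb{C}_n,n\in\mathbb{Z})$ of partitions of $\Omega$, each consisting of countably many disjoint sets, $\mathbb{C}_n\subset\mathcal{F}^0$, such that, denoting by $C_n(x)$ the unique $C\in\mathbb{C}_n$ containing $x$: (i) $\inf_{C\in\mathbb{C}_n}|C|\to\infty$ as $n\to-\infty$ and $\lim_{n\to\infty}f_{C_n(x)}=f(x)$ a.e. for every $f\in\mathbb{L}$; (ii) for each $n$ and $C\in\mathbb{C}_n$ there is a (unique) $C'\in\mathbb{C}_{n-1}$ with $C\subset C'$; (iii) for $n,C,C'$ as in (ii), $|C'|\le N_0|C|$ with a constant $N_0$ independent of $n,C,C'$. Set $\mathbb{C}_\infty=\bigcup_n\mathbb{C}_n$. For $f\in L_{1,\mathrm{loc}}(\Omega)$: $f_{|n}(x)=⨍_{C_n(x)}f\,d\mu$; $\mathcal{M}f(x)=\sup_{n\in\mathbb{Z}}|f|_{|n}(x)$; for $v\ge 0$,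 $\mathcal{M}_m v=\sup_{n\le m}v_{|n}$; and $$u^{\#}_{\gamma,m}(x)=\sup_{n\ge m}\ \sup_{C\in\mathbb{C}_n,\,C\ni x}\Big(\frac{1}{|C|^2}\int_C\int_C|u(z)-u(y)|^\gamma\,\mu(dz)\mu(dy)\Big)^{1/\gamma}.$$ Weight of $\beta$-type: a nonnegative function $w$ on $\Omega$ such that, with $\chi(A):=\int_A w\,d\mu$, one has $\chi(C)<\infty$ for every $C\in\mathbb{C}_\infty$ and $\dfrac{\chi(A)}{\chi(C)}\le N_{w,\beta}\dfrac{|A|^\beta}{|C|^\beta}$ for all measurable $A\subset C$ and all $C\in\mathbb{C}_\infty$, where $N_{w,\beta}<\infty$ is independent of $A$ and $C$. *)

(* Defs.v *)
From HB Require Import structures.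
From mathcomp Require Import all_boot all_order all_algebra.
From mathcomp Require Import all_classical all_reals all_analysis measurable_realfun.

Set Implicit Arguments.
Unset Strict Implicit.
Unset Printing Implicit Defensive.
Import Order.TTheory GRing.Theory Num.Theory.
Import numFieldNormedType.Exports.

Local Open Scope classical_set_scope.
Local Open Scope ring_scope.
Local Open Scope ereal_scope.

Section averages.
Context d (T : measurableType d) (R : realType).
Variable mu : {measure set T -> \bar R}.

Definition L1loc (f : T -> R) : Prop :=
  forall A, measurable A -> mu A < +oo -> (f \* \1_A)%R \in Lfun mu 1.

Definition L1dense (LL : set (T -> R)) : Prop :=
  (forall g, LL g -> g \in Lfun mu 1) /\
  (forall f, f \in Lfun mu 1 -> forall e : R, (0 < e)%R ->
     exists2 g, LL g & 'N[mu]_1[EFin \o (f \- g)%R] < e%:E).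

(* In \bar R, 0^-1 = +oo and 0 * +oo = 0, so x / 0 is the paper's 0/0 := 0
   when x = 0; this is the case here as soon as mu A = 0. *)
Definition average (f : T -> R) (A : set T) : \bar R :=
  (\int[mu]_(x in A) (f x)%:E) / mu A.

Variable CC : int -> set (set T).

(* C_n(x); meaningful when CC n is a partition of the whole space *)
Definition cell (n : int) (x : T) : set T := pblock (CC n) id x.

Definition partition_average (f : T -> R) (n : int) (x : T) : \bar R :=
  average f (cell n x).

(* Limits in n : int are taken along n = k and n = - k with k : nat, k --> oo *)
Record filtration_of_partitions (LL : set (T -> R)) (N0 : R) : Prop := {
  fp_partition : forall n, partition (CC n) id [set: T] ;
  fp_countable : forall n, countable (CC n) ;
  fp_measurable : forall n C, CC n C -> measurable C ;
  fp_finite : forall n C, CC n C -> mu C < +oo ;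
  fp_inf : ereal_inf [set mu C | C in CC (- k%:Z)%R] @[k --> \oo] --> +oo ;
  fp_lebesgue : forall f, LL f ->
    {ae mu, forall x, partition_average f k%:Z x @[k --> \oo] --> (f x)%:E} ;
  fp_nested : forall n C, CC n C -> exists! C', CC (n - 1)%R C' /\ C `<=` C' ;
  fp_regular : forall n C C', CC n C -> CC (n - 1)%R C' -> C `<=` C' ->
    mu C' <= N0%:E * mu C }.

Definition maximal (f : T -> R) (x : T) : \bar R :=
  ereal_sup [set partition_average (fun y => `|f y|%R) n x | n in [set: int]].

Definition maximal_le (m : int) (v : T -> R) (x : T) : \bar R :=
  ereal_sup [set partition_average v n x | n in [set n | (n <= m)%R]].

Definition oscillation (gamma : R) (u : T -> R) (C : set T) : \bar R :=
  (mu C ^+ 2)^-1 *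
  \int[mu]_(y in C) \int[mu]_(z in C) (`|u z - u y| `^ gamma)%:E.

Definition sharp (gamma : R) (m : int) (u : T -> R) (x : T) : \bar R :=
  ereal_sup [set ereal_sup [set oscillation gamma u C `^ gamma^-1
                           | C in [set C | CC n C /\ C x]]
            | n in [set n | (m <= n)%R]].

End averages.

Section weights.
Context d (T : measurableType d) (R : realType).
Variables (mu : {measure set T -> \bar R}) (w : T -> R).
Hypotheses (mw : measurable_fun [set: T] w) (w0 : forall x, (0 <= w x)%R).

(* The proofs of measurability and nonnegativity are arguments so that the
   set function A |-> \int_A w dmu can be equipped with a measure structure. *)
Definition weight_measure of measurable_fun [set: T] w &
    (forall x, (0 <= w x)%R) := fun A => \int[mu]_(x in A) (w x)%:E.

Local Notation chi := (weight_measure mw w0).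

Let chi0 : chi set0 = 0.
Proof. exact: integral_set0. Qed.

Let chi_ge0 A : 0 <= chi A.
Proof. by apply: integral_ge0 => x _; rewrite lee_fin. Qed.

Let chi_sigma_additive : semi_sigma_additive chi.
Proof.
apply: semi_sigma_additive_nng_induced; first exact/measurable_EFinP.
by move=> x; rewrite lee_fin.
Qed.

HB.instance Definition _ :=
  isMeasure.Build d T R chi chi0 chi_ge0 chi_sigma_additive.

End weights.
Arguments weight_measure {d T R} mu {w} mw w0 _.

(* When chi C = 0, also chi A = 0 and chi A / chi C = 0, as for average. *)
Definition beta_type d (T : measurableType d) (R : realType)
    (mu : {measure set T -> \bar R}) (CC : int -> set (set T)) (beta Nw : R)
    (chi : {measure set T -> \bar R}) : Prop :=
  forall C, (\bigcup_n CC n) C -> chi C < +oo /\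
    forall A, measurable A -> A `<=` C ->
      chi A / chi C <= Nw%:E * (mu A `^ beta / mu C `^ beta).

(* Main.v *)
Require Import Defs.
From HB Require Import structures.
From mathcomp Require Import all_boot all_order all_algebra.
From mathcomp Require Import all_classical all_reals all_analysis measurable_realfun.
From mathcomp Require Import ring lra zify.

Set Implicit Arguments.
Unset Strict Implicit.
Unset Printing Implicit Defensive.
Import Order.TTheory GRing.Theory Num.Theory.
Import numFieldNormedType.Exports.

Local Open Scope classical_set_scope.
Local Open Scope ring_scope.
Local Open Scope ereal_scope.

(* Fix l > 0 and stop the averages of v = |u| when they first exceed l / (4 N0).
   The stopping cells C are disjoint, v <= Mu a.e. makes them cover {v > l} up
   to a null set, and regularity gives average(v, C) <= l / 4; hence v <= l / 2
   on at least half of C.  On C x C the difference |u z - u y| is then at least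
   l / 2 on a set of measure at least |C \cap {v > l}| |C| / 2, so that, F being
   the integrand of J before raising to the power p,
     |C \cap {v > l}| / |C| <= 2 (2 / l)^gamma F(x)^gamma  for all x in C
   (for the cells of level below m, Chebyshev's inequality for v^gamma is used
   instead).  The beta-type condition turns this into the good-lambda bound
     chi {v > l} <= K l^(- gamma beta)
                    \int_{Mu > l / (4 N0)} F^(gamma beta) dchi.
   Multiplying by l^p and summing over dyadic l yields
     \int v^p dchi <= N \int (Mu)^(p - gamma beta) F^(gamma beta) dchi,
   and Hoelder's inequality concludes. *)

(** * Countable unions: measurability and integrals *)

(** An injection of [S] into the naturals sorts the sets into a sequence, numbers outside its image
    getting the empty set. Results on sequences of sets thus apply to families of cells. *)
Lemma countable_bigcup_enum T I (S : set I) (P : I -> set T) : countable S ->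
  exists F : (set T)^nat,
    [/\ \bigcup_n F n = \bigcup_(i in S) P i,
        forall n, F n = set0 \/ exists2 i, S i & F n = P i &
        trivIset S P -> trivIset [set: nat] F].
Proof.
move=> /countable_injP[f finj].
exists (fun n => \bigcup_(i in [set i | S i /\ f i = n]) P i); split.
- apply/seteqP; split=> x.
    by move=> [n _ [i [Si _] Pix]]; exists i.
  by move=> [i Si Pix]; exists (f i) => //; exists i.
- move=> n; have [[i [Si fin]]|nS] := pselect (exists i, S i /\ f i = n).
    right; exists i => //; apply/seteqP; split=> x; last by exists i.
    move=> [j [Sj fjn] Pjx]; rewrite (finj i j) ?inE//.
    by rewrite fjn.
  by left; rewrite -subset0 => x [i [Si fin] _]; apply: nS; exists i.
- move=> tP n k _ _ [x [[i [Si <-] Pix] [j [Sj <-] Pjx]]].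
  by congr f; apply: tP => //; exists x.
Qed.

Lemma countable_bigcup_measurable d (T : measurableType d) I (S : set I)
    (P : I -> set T) :
  countable S -> (forall i, S i -> measurable (P i)) ->
  measurable (\bigcup_(i in S) P i).
Proof.
move=> cS mP; have [F [<- FP _]] := countable_bigcup_enum P cS.
by apply: bigcupT_measurable => n; have [->|[i Si ->]] := FP n; [|exact: mP].
Qed.

Lemma measurable_fun_ereal_sup d (T : measurableType d) (R : realType) I
    (S : set I) (f : I -> T -> \bar R) :
  countable S -> (forall i, S i -> measurable_fun [set: T] (f i)) ->
  measurable_fun [set: T] (fun x => ereal_sup [set f i x | i in S]).
Proof.
move=> cS mf; apply: (measurability _ (ErealGenOInfty.measurableE R)) => //.
move=> _ [_ [a ->] <-]; rewrite setTI.
rewrite (_ : _ @^-1` _ = \bigcup_(i in S) [set x | a%:E < f i x]).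
  apply: countable_bigcup_measurable => // i Si.
  by have := emeasurable_fun_o_infty measurableT (mf i Si) a%:E; rewrite setTI.
apply/seteqP; split=> x /=; rewrite in_itv/= andbT.
  by move=> /ereal_sup_gtP[_ [i Si <-] afx]; exists i.
by move=> [i Si /= afx]; apply/ereal_sup_gtP; exists (f i x) => //; exists i.
Qed.

(** A preimage is the union of the cells that it contains, and these are countably many. *)
Lemma measurable_fun_cst_cells d (T : measurableType d) d'
    (U : measurableType d') (P : set (set T)) (f : T -> U) :
  countable P -> (forall C, P C -> measurable C) -> cover P id = [set: T] ->
  (forall C x y, P C -> C x -> C y -> f x = f y) ->
  measurable_fun [set: T] f.
Proof.
move=> cP mP covP fP _ B mB; rewrite setTI.
rewrite (_ : f @^-1` B = \bigcup_(C in [set C | P C /\ C `<=` f @^-1` B]) C).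
  apply: countable_bigcup_measurable => [|C [PC _]]; last exact: mP.
  by apply: sub_countable cP; apply: subset_card_le => C [].
apply/seteqP; split=> [x /= Bfx|x [C [PC CB] Cx]]; last exact: CB.
have : [set: T] x by [].
rewrite -covP => -[C PC /= Cx]; exists C => //; split=> // y Cy /=.
by rewrite (fP C y x).
Qed.

Lemma ge0_le_integral_bigcup d (T : measurableType d) (R : realType)
    (m1 m2 : {measure set T -> \bar R}) (S : set (set T)) (f g : T -> \bar R) :
  countable S -> trivIset S id -> (forall C, S C -> measurable C) ->
  measurable_fun [set: T] f -> measurable_fun [set: T] g ->
  (forall x, 0 <= f x) -> (forall x, 0 <= g x) ->
  (forall C, S C -> \int[m1]_(x in C) f x <= \int[m2]_(x in C) g x) ->
  \int[m1]_(x in \bigcup_(C in S) C) f x <=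
  \int[m2]_(x in \bigcup_(C in S) C) g x.
Proof.
move=> cS tS mS mf mg f0 g0 fg.
have [F [<- FS /(_ tS) tF]] := countable_bigcup_enum id cS.
have mF k : measurable (F k) by have [->|[C SC ->]] := FS k; [|exact: mS].
rewrite !ge0_integral_bigcup//; [|exact: measurable_funTS..].
apply: lee_nneseries => [i _ _|i _]; first exact: integral_ge0.
by have [->|[C SC ->]] := FS i; [rewrite !integral_set0|exact: fg].
Qed.

(** * Young's and Hoelder's inequalities *)

(** Young's inequality with conjugate exponents 1/s and 1/t, applied to the powers x^s and y^t. *)
Lemma young_powR (R : realType) (s t x y : R) :
  (0 < s)%R -> (0 < t)%R -> (s + t = 1)%R -> (0 <= x)%R -> (0 <= y)%R ->
  (x `^ s * y `^ t <= s * x + t * y)%R.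
Proof.
move=> s0 t0 st1 x0 y0.
have := @conjugate_powR R (x `^ s)%R (y `^ t)%R s^-1%R t^-1%R.
rewrite !powR_ge0 !invr_gt0 !invrK -!powRrM !divff ?gt_eqF// !powRr1//.
by rewrite (mulrC s) (mulrC t); exact.
Qed.

Lemma ae_eq0_le_integral d (T : measurableType d) (R : realType)
    (mu : {measure set T -> \bar R}) (f g : T -> \bar R) :
  measurable_fun [set: T] f -> measurable_fun [set: T] g ->
  (forall x, 0 <= f x) -> (forall x, 0 <= g x) ->
  (forall x, g x = 0 -> f x = 0) ->
  \int[mu]_x g x = 0 -> \int[mu]_x f x = 0.
Proof.
move=> mf mg f0 g0 gf g_eq0.
have : \int[mu]_x `|g x| = 0.
  by rewrite -g_eq0; apply: eq_integral => x _; rewrite gee0_abs.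
move=> /(ae_eq_integral_abs _ measurableT mg) ae_g.
rewrite -(integral0 mu [set: T]).
apply: ge0_ae_eq_integral => //.
by apply: filterS ae_g => x /= /[apply]; exact: gf.
Qed.

(** With a and b the integrals of [f] and [g], Young's inequality is applied to f/a and g/b and
    integrated. Zero and infinite integrals are settled separately. *)
Lemma hoelder_poweR d (T : measurableType d) (R : realType)
    (mu : {measure set T -> \bar R}) (f g : T -> \bar R) (s t : R) :
  measurable_fun [set: T] f -> measurable_fun [set: T] g ->
  (forall x, 0 <= f x) -> (forall x, 0 <= g x) ->
  (0 < s)%R -> (0 < t)%R -> (s + t = 1)%R ->
  \int[mu]_x (f x `^ s * g x `^ t) <=
  (\int[mu]_x f x) `^ s * (\int[mu]_x g x) `^ t.
Proof.
move=> mf mg f0 g0 s0 t0 st1.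
have mfp : measurable_fun [set: T] (fun x => f x `^ s).
  exact: (measurableT_comp (measurable_poweR s)).
have mgp : measurable_fun [set: T] (fun x => g x `^ t).
  exact: (measurableT_comp (measurable_poweR t)).
have mfg : measurable_fun [set: T] (fun x => f x `^ s * g x `^ t).
  exact: emeasurable_funM.
have fg0 x : 0 <= f x `^ s * g x `^ t by rewrite mule_ge0// poweR_ge0.
(* Zero integrals come first: the other integral may be +oo, and then the right-hand side is still
   0. *)
have [A0|A0] := eqVneq (\int[mu]_x f x) 0.
  rewrite (ae_eq0_le_integral mfg mf)//; last first.
    by move=> x ->; rewrite poweR0r ?gt_eqF// mul0e.
  by rewrite mule_ge0// poweR_ge0.
have [B0|B0] := eqVneq (\int[mu]_x g x) 0.
  rewrite (ae_eq0_le_integral mfg mg)//; last first.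
    by move=> x ->; rewrite poweR0r ?gt_eqF// mule0.
  by rewrite mule_ge0// poweR_ge0.
have Agt0 : 0 < \int[mu]_x f x by rewrite lt0e A0 integral_ge0.
have Bgt0 : 0 < \int[mu]_x g x by rewrite lt0e B0 integral_ge0.
case EA : (\int[mu]_x f x) Agt0 => [a||]; last by rewrite ltNge leNye.
  rewrite lte_fin => a0.
  case EB : (\int[mu]_x g x) Bgt0 => [b||]; last by rewrite ltNge leNye.
    rewrite lte_fin => b0.
    (* [c] is the target bound; the two terms with weights c s / a and c t / b integrate to c (s +
       t) = c. *)
    pose c : R := (a `^ s * b `^ t)%R.
    have c0 : (0 < c)%R by rewrite mulr_gt0// powR_gt0.
    have sa0 : (0 < c * s / a)%R by rewrite divr_gt0// mulr_gt0.
    have tb0 : (0 < c * t / b)%R by rewrite divr_gt0// mulr_gt0.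
    apply: (@le_trans _ _ 
      (\int[mu]_x ((c * s / a)%:E * f x + (c * t / b)%:E * g x))).
      apply: ge0_le_integral => //.
        apply: emeasurable_funD; exact: measurable_funeM.
      move=> x _; case: (f x) (f0 x) (g x) (g0 x) => [y||]// y0 [z||]// z0.
      + rewrite !poweR_EFin -!EFinM -EFinD lee_fin.
        have ya0 : (0 <= y / a)%R by rewrite divr_ge0// ltW.
        have zb0 : (0 <= z / b)%R by rewrite divr_ge0// ltW.
        have := ler_wpM2l (ltW c0) (young_powR s0 t0 st1 ya0 zb0).
        congr (_ <= _)%R.
          rewrite /c mulrACA -!powRM ?(ltW a0) ?(ltW b0)//.
          by rewrite !mulrA [(a * y)%R]mulrC [(b * z)%R]mulrC !mulfK ?gt_eqF.
        by rewrite mulrDr; congr (_ + _)%R; ring.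
      + by rewrite gt0_muley ?lte_fin// addey ?leey// -EFinM.
      + by rewrite gt0_muley ?lte_fin// addye ?leey// -EFinM.
      + by rewrite !gt0_muley ?lte_fin// leey.
    rewrite ge0_integralD//; first last.
    - exact: measurable_funeM.
    - by move=> x _; rewrite mule_ge0// lee_fin ltW.
    - exact: measurable_funeM.
    - by move=> x _; rewrite mule_ge0// lee_fin ltW.
    rewrite !ge0_integralZl_EFin ?(ltW sa0) ?(ltW tb0)//.
    rewrite EA EB -!EFinM -EFinD lee_fin !divfK ?gt_eqF//.
    by rewrite -mulrDr st1 mulr1.
  by move=> _; rewrite poweRyr ?gt_eqF// gt0_muley ?leey// poweR_gt0.
by move=> _; rewrite poweRyr ?gt_eqF// gt0_mulye ?leey// poweR_gt0.
Qed.

(** * Dyadic sums of powers *)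

(** One term suffices: the first dyadic level a / 2^(j+1) below v satisfies v <= 2 a / 2^(j+1).
    Induction on [N] halves [a] until that level is reached; a / 2^N < v ensures that it occurs. *)
Lemma powR_le_dyadic_sum (R : realType) (p a v : R) N :
  (0 < p)%R -> (0 < v)%R -> (v <= a)%R -> (a / 2 ^+ N < v)%R ->
  (v `^ p <=
   \sum_(j < N) (2 * (a / 2 ^+ j.+1)) `^ p * (a / 2 ^+ j.+1 < v)%R%:R)%R.
Proof.
move=> p0 v0; elim: N a => [|N IH] a va aNv.
  by move: aNv; rewrite expr0 divr1 ltNge va.
rewrite big_ord_recl/= expr1.
have [av|va2] := ltP (a / 2)%R v; last first.
  rewrite mulr0 add0r; apply: le_trans (IH _ va2 _) _.
    by rewrite -mulrA -invfM -exprS.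
  by apply: ler_sum => j _; rewrite -mulrA -invfM -exprS.
rewrite mulr1 mulrC divfK ?pnatr_eq0// -[leLHS]addr0 lerD//.
  rewrite ge0_ler_powR ?nnegrE// ?(ltW p0)// ?(ltW v0)//.
  by rewrite (le_trans _ va)// ltW.
by apply: sumr_ge0 => j _; rewrite mulr_ge0 ?powR_ge0.
Qed.

Lemma powR_half_lt1 (R : realType) (q : R) : (0 < q)%R -> (2^-1 `^ q < 1)%R.
Proof.
move=> q0; rewrite -[ltRHS](_ : 1 `^ q = 1)%R; last by rewrite powR1.
by rewrite gt0_ltr_powR// ?nnegrE// invf_lt1// ltr1n.
Qed.

(** The powers of the levels below [M] form a geometric progression of ratio 2^(-q) whose first term
    is at most M^q. *)
Lemma dyadic_sum_le_powR (R : realType) (q a M : R) N :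
  (0 < q)%R -> (0 < a)%R -> (0 <= M)%R ->
  (\sum_(j < N) (a / 2 ^+ j.+1) `^ q * (a / 2 ^+ j.+1 < M)%R%:R
   <= M `^ q / (1 - 2^-1 `^ q))%R.
Proof.
move=> q0 a0 M0; set r := (2^-1 `^ q)%R.
have r1 : (r < 1)%R by exact: powR_half_lt1.
have r10 : (0 < 1 - r)%R by rewrite subr_gt0.
have halve (b : R) j : (b / 2 / 2 ^+ j = b / 2 ^+ j.+1)%R.
  by rewrite -mulrA -invfM -exprS.
(* The bound reproduces itself: with B = (b/2)^q, one has B + r B / (1 - r) = B / (1 - r). *)
have geom K (b : R) : (0 <= b)%R ->
    (\sum_(j < K) (b / 2 ^+ j.+1) `^ q <= (b / 2) `^ q / (1 - r))%R.
  elim: K b => [|K IH] b b0.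
    by rewrite big_ord0 divr_ge0 ?powR_ge0// ltW.
  rewrite big_ord_recl/= expr1.
  under eq_bigr => j _ do rewrite /bump/= add1n -halve.
  apply: le_trans (lerD (lexx _) (IH _ _)) _; first by rewrite divr_ge0.
  rewrite [((b / 2 / 2) `^ q)%R]powRM ?divr_ge0// -/r.
  rewrite ler_pdivlMr// mulrDl divfK ?gt_eqF//.
  by rewrite -mulrDr subrK mulr1.
elim: N a a0 => [|N IH] a a0.
  by rewrite big_ord0 divr_ge0 ?powR_ge0// ltW.
have [aM|Ma] := ltP (a / 2)%R M.
  apply: (@le_trans _ _ (\sum_(j < N.+1) (a / 2 ^+ j.+1) `^ q)%R).
    by apply: ler_sum => j _; rewrite ler_piMr ?powR_ge0//; case: (_ < _)%R.
  apply: le_trans (geom _ _ (ltW a0)) _.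
  rewrite ler_wpM2r ?invr_ge0 ?(ltW r10)//.
  by rewrite ge0_ler_powR ?nnegrE ?(ltW q0)// ?ltW// divr_gt0.
rewrite big_ord_recl/= expr1 ltNge Ma mulr0 add0r.
under eq_bigr => j _ do rewrite /bump/= add1n -halve.
by apply: IH; rewrite divr_gt0.
Qed.

(** * Cells of the filtration *)

Section filtration.
Context d (T : measurableType d) (R : realType).
Variables (mu : {measure set T -> \bar R}) (LL : set (T -> R)).
Variables (CC : int -> set (set T)) (N0 : R).
Hypothesis fil : filtration_of_partitions mu CC LL N0.

Lemma cellP n x : CC n (cell CC n x) /\ cell CC n x x.
Proof.
have [covn _ _] := fp_partition fil n.
have : [set: T] x by [].
rewrite -covn => -[C CnC Cx].
by apply: (@getPex (set T) (fun C => CC n C /\ C x)); exists C.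
Qed.

Lemma cell_level n x : CC n (cell CC n x). Proof. by case: (cellP n x). Qed.

Lemma cell_self n x : cell CC n x x. Proof. by case: (cellP n x). Qed.

Lemma cell_eq n x C : CC n C -> C x -> cell CC n x = C.
Proof.
move=> CnC Cx; have [_ tI _] := fp_partition fil n.
by apply: tI => //; [exact: cell_level|exists x; split=> //; exact: cell_self].
Qed.

Lemma cell_nested k n x : (k <= n)%R -> cell CC n x `<=` cell CC k x.
Proof.
rewrite -subr_ge0; case: (n - k)%R (subrK k n) => // j <- _.
elim: j => [|j IH]; first by rewrite add0r.
apply: subset_trans IH.
have [C' [[CC' sC'] _]] := fp_nested fil (cell_level (j.+1%:Z + k)%R x).
have -> : (j%:Z + k = j.+1%:Z + k - 1)%R by lia.
by rewrite (cell_eq CC')//; apply/sC'/cell_self.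
Qed.

Lemma cell_measurable n x : measurable (cell CC n x).
Proof. exact: fp_measurable fil _ _ (cell_level n x). Qed.

Lemma cell_mu_lty n x : mu (cell CC n x) < +oo.
Proof. exact: fp_finite fil _ _ (cell_level n x). Qed.

Lemma cell_parent n x :
  mu (cell CC (n - 1)%R x) <= N0%:E * mu (cell CC n x).
Proof.
apply: (fp_regular fil) (cell_level n x) (cell_level (n - 1) x) _.
by apply: cell_nested; rewrite gerBl.
Qed.

(* A null cell would have only null ancestors, although the measures of the
   cells tend to infinity as the level tends to -oo. *)
Lemma cell_mu_gt0 n x : 0 < mu (cell CC n x).
Proof.
rewrite lt0e measure_ge0 andbT; apply/eqP => mu0.
have mu0j j : mu (cell CC (n - j%:Z)%R x) = 0.
  elim: j => [|j IH]; first by rewrite subr0.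
  apply/eqP; rewrite eq_le measure_ge0 andbT.
  have := cell_parent (n - j%:Z)%R x; rewrite IH mule0.
  by have -> : (n - j%:Z - 1 = n - j.+1%:Z)%R by lia.
have /cvgeyPge/(_ 1%R)[k _ kP] := fp_inf fil.
pose j := (k + absz n)%N.
have := kP j (leq_addr _ _); apply/negP; rewrite -ltNge.
apply: le_lt_trans (_ : 0 < 1%R%:E); last by rewrite lte_fin.
have [i ij] : exists i : nat, (- j%:Z = n - i%:Z)%R.
  by exists (absz (n + j%:Z)%R); rewrite /j; lia.
rewrite -(mu0j i) -ij; apply: ereal_inf_lbound => /=.
by exists (cell CC (- j%:Z)%R x) => //; exact: cell_level.
Qed.

(** Makes division by the measure of a cell ordinary real division. *)
Lemma cell_muE n x :
  exists2 c : R, (0 < c)%R & mu (cell CC n x) = c%:E.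
Proof.
have := cell_mu_gt0 n x; have := cell_mu_lty n x.
by case: (mu _) => [c _||]//; rewrite lte_fin => c0; exists c.
Qed.

Lemma level_cell n C : CC n C -> exists x, C = cell CC n x.
Proof.
move=> CnC; have [_ _ /(_ _ CnC)[x Cx]] := fp_partition fil n.
by exists x; rewrite (cell_eq CnC Cx).
Qed.

Lemma cell_cst n C x y : CC n C -> C x -> C y -> cell CC n x = cell CC n y.
Proof. by move=> CnC Cx Cy; rewrite (cell_eq CnC Cx) (cell_eq CnC Cy). Qed.

Lemma measurable_cell_cst d' (U : measurableType d') n (f : T -> U) :
  (forall x y, cell CC n x = cell CC n y -> f x = f y) ->
  measurable_fun [set: T] f.
Proof.
move=> fP; have [cov _ _] := fp_partition fil n.
apply: measurable_fun_cst_cells (fp_countable fil n) _ cov _.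
  by move=> C; exact: (fp_measurable fil).
by move=> C x y CnC Cx Cy; apply/fP/(cell_cst CnC).
Qed.

Lemma measurable_partition_average (v : T -> R) n :
  measurable_fun [set: T] (partition_average mu CC v n).
Proof.
apply: (measurable_cell_cst (n := n)) => x y.
by rewrite /partition_average => ->.
Qed.

Lemma measurable_maximal (v : T -> R) :
  measurable_fun [set: T] (maximal mu CC v).
Proof.
apply: (measurable_fun_ereal_sup
  (f := partition_average mu CC (fun y => `|v y|%R))) => [|n _].
  exact: countableP.
exact: measurable_partition_average.
Qed.

Lemma measurable_maximal_le m (v : T -> R) :
  measurable_fun [set: T] (maximal_le mu CC m v).
Proof.
apply: (measurable_fun_ereal_sup (f := partition_average mu CC v)) => [|n _].
  exact: countableP.
exact: measurable_partition_average.
Qed.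

Lemma measurable_sharp g m (v : T -> R) :
  measurable_fun [set: T] (sharp mu CC g m v).
Proof.
apply: (measurable_fun_ereal_sup (S := [set n | (m <= n)%R])
  (f := fun n x => ereal_sup [set oscillation mu g v C `^ g^-1
                             | C in [set C | CC n C /\ C x]])) => [|n _].
  exact: countableP.
apply: (measurable_cell_cst (n := n)) => x y xy.
congr (ereal_sup [set _ | _ in _]).
apply/seteqP; split=> C [CnC Cx]; split=> //.
  by rewrite -(cell_eq CnC Cx) xy; exact: cell_self.
by rewrite -(cell_eq CnC Cx) -xy; exact: cell_self.
Qed.

(** Local integrability speaks of restrictions to sets of finite measure; the countably many cells
    of level 0 glue these together. *)
Lemma measurable_L1loc (u : T -> R) : L1loc mu u -> measurable_fun [set: T] u.
Proof.
move=> uloc; have [cov _ _] := fp_partition fil 0%R.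
have [F [FE FP _]] := countable_bigcup_enum id (fp_countable fil 0%R).
have mF i : measurable (F i).
  by have [->|[C C0 ->]] := FP i; [|exact: fp_measurable fil _ _ C0].
rewrite -cov /cover -FE; apply/measurable_fun_bigcup => // i.
have Flty : mu (F i) < +oo.
  have [->|[C C0 ->]] := FP i; first by rewrite measure0.
  exact: fp_finite fil _ _ C0.
have /sub_Lfun_mfun/set_mem/= mu1 := uloc _ (mF i) Flty.
apply: (eq_measurable_fun (u \* \1_(F i))%R).
  by move=> x xF /=; rewrite indicE xF mulr1.
exact: measurable_funTS.
Qed.

End filtration.

(** * Stopping cells *)

Section stopping.
Context d (T : measurableType d) (R : realType).
Variables (mu : {measure set T -> \bar R}) (LL : set (T -> R)).
Variables (CC : int -> set (set T)) (N0 : R).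
Hypothesis fil : filtration_of_partitions mu CC LL N0.

Lemma average_ge0 (v : T -> R) A : (forall x, (0 <= v x)%R) ->
  0 <= average mu v A.
Proof.
move=> v0; rewrite mule_ge0 ?inve_ge0//.
by apply: integral_ge0 => x _; rewrite lee_fin.
Qed.

Lemma integral_cellE (v : T -> R) n x :
  \int[mu]_(y in cell CC n x) (v y)%:E =
  partition_average mu CC v n x * mu (cell CC n x).
Proof.
have [c c0 cE] := cell_muE fil n x.
rewrite /partition_average /average cE -muleA inver gt_eqF// -EFinM.
by rewrite mulVf ?gt_eqF// mule1.
Qed.

(** Passing to the parent cell can only enlarge the integral of the nonnegative [v], and it
    multiplies the measure by at most [N0]. *)
Lemma partition_average_parent (v : T -> R) n x :
  measurable_fun [set: T] v -> (forall x, (0 <= v x)%R) ->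
  partition_average mu CC v n x <=
  N0%:E * partition_average mu CC v (n - 1)%R x.
Proof.
move=> mv v0.
have [c c0 cE] := cell_muE fil n x.
have [c' c'0 c'E] := cell_muE fil (n - 1)%R x.
have := cell_parent fil n x; rewrite cE c'E -EFinM lee_fin => c'c.
have N0_ge0 : (0 <= N0)%R.
  by rewrite -(pmulr_lge0 _ c0) (le_trans _ c'c)// ltW.
rewrite -(@lee_pmul2r _ c%:E)// ?lte_fin//.
rewrite -cE -integral_cellE cE.
apply: le_trans (_ : \int[mu]_(y in cell CC (n - 1)%R x) (v y)%:E <= _).
  apply: ge0_subset_integral.
  - exact: cell_measurable fil _ _.
  - exact: cell_measurable fil _ _.
  - exact/measurable_EFinP/measurable_funTS.
  - by move=> y _; rewrite lee_fin.
  - by apply: (cell_nested fil); rewrite gerBl.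
rewrite integral_cellE c'E [leRHS]muleAC -EFinM muleC.
by rewrite lee_wpmul2r ?lee_fin// average_ge0.
Qed.

(** The Calderon-Zygmund cells of [v] at height [l]: the first cells, from coarse to fine, whose
    average exceeds [l]. The level is quantified because one set may be a cell of several levels. *)
Definition stopping (v : T -> R) (l : R) : set (set T) :=
  [set C | exists n, [/\ CC n C, l%:E < average mu v C &
    forall k x, (k < n)%R -> C x -> partition_average mu CC v k x <= l%:E]].

Lemma stopping_level v l C : stopping v l C -> (\bigcup_n CC n) C.
Proof. by move=> [n [CnC _ _]]; exists n. Qed.

Lemma stopping_countable v l : countable (stopping v l).
Proof.
apply: (@sub_countable _ _ _ (\bigcup_n CC n)).
  by apply: subset_card_le => C; exact: stopping_level.
by apply: bigcup_countable => // n _; exact: fp_countable fil n.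
Qed.

Lemma stopping_measurable v l C : stopping v l C -> measurable C.
Proof. by move=> [n [CnC _ _]]; exact: fp_measurable fil _ _ CnC. Qed.

(** Of two stopping cells with a common point, neither can have the smaller level, since its large
    average would violate the stopping condition of the other. Equal levels and a common point give
    equal cells. *)
Lemma stopping_trivIset v l : trivIset (stopping v l) id.
Proof.
have aux C D n k x : CC n C -> CC k D -> C x -> D x ->
    l%:E < average mu v C ->
    (forall j x, (j < k)%R -> D x -> partition_average mu CC v j x <= l%:E) ->
    (k <= n)%R.
  move=> CnC CkD Cx Dx lC kD; rewrite leNgt; apply/negP => nk.
  have := kD _ _ nk Dx.
  by rewrite /partition_average (cell_eq fil CnC Cx) leNgt lC.
move=> C D [n [CnC lC nC]] [k [CkD lD kD]] [x [Cx Dx]].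
have nk : n = k.
  by apply/eqP; rewrite eq_le (aux D C k n x)// (aux C D n k x).
by rewrite -(cell_eq fil CnC Cx) nk (cell_eq fil CkD Dx).
Qed.

(** The averages tend to 0 towards level -oo, so the levels where the average at [x] exceeds [l] are
    bounded below; the least of them yields the stopping cell. *)
Lemma stopping_cover v l x :
  (0 < l)%R -> partition_average mu CC v (- k%:Z)%R x @[k --> \oo] --> 0 ->
  l%:E < ereal_sup [set partition_average mu CC v n x | n in [set: int]] ->
  (\bigcup_(C in stopping v l) C) x.
Proof.
move=> l0 v_to0 /ereal_sup_gtP[_ [n _ <-] ln].
have [K _ Kl] : \forall k \near \oo,
    partition_average mu CC v (- k%:Z)%R x < l%:E.
  exact: v_to0 _ (@nbhs_open_ereal_lt R 0%R (fun=> l) l0).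
(* Levels are counted from -K, at and below which the averages stay under [l], so that the least one
   is a minimum over naturals. *)
have exj : exists j : nat, l%:E < partition_average mu CC v (j%:Z - K%:Z)%R x.
  have Kn : (- K%:Z < n)%R.
    rewrite ltNge; apply/negP => nK.
    have := Kl (absz n); rewrite /= => /(_ _).
    rewrite ltNge => /(_ _)/negP; apply.
      by lia.
    by rewrite ltW//; have -> : (- (absz n)%:Z = n)%R by lia.
  exists (absz (n + K%:Z)%R).
  by have -> : ((absz (n + K%:Z)%R)%:Z - K%:Z = n)%R by lia.
case: (ex_minnP exj) => j lj jmin.
exists (cell CC (j%:Z - K%:Z)%R x); last exact: cell_self fil _ _.
exists (j%:Z - K%:Z)%R; split=> //; first exact: cell_level fil _ _.
move=> k y kj yx.
have -> : partition_average mu CC v k y = partition_average mu CC v k x.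
  rewrite /partition_average; congr average.
  apply: (cell_eq fil (cell_level fil k x)).
  exact: (cell_nested fil (ltW kj)).
rewrite leNgt; apply/negP => lk.
(* Levels up to -K are excluded by [Kl], those above by the minimality of [j]. *)
have [kK|Kk] := leP k (- K%:Z)%R.
  have := Kl (absz k); rewrite /= => /(_ _).
  rewrite ltNge => /(_ _)/negP; apply.
    by lia.
  by rewrite ltW//; have -> : (- (absz k)%:Z = k)%R by lia.
have := jmin (absz (k + K%:Z)%R).
have -> : ((absz (k + K%:Z)%R)%:Z - K%:Z = k)%R by lia.
by move=> /(_ lk); lia.
Qed.

(** The parent precedes the stopping level, so its average is at most [l]; regularity costs the
    factor [N0]. *)
Lemma stopping_average_le (v : T -> R) (l : R) C :
  measurable_fun [set: T] v -> (forall x, (0 <= v x)%R) ->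
  (0 <= N0)%R -> stopping v l C -> average mu v C <= (N0 * l)%:E.
Proof.
move=> mv v0 N00 [n [CnC _ nC]].
have [x CE] := level_cell fil CnC.
rewrite CE; apply: le_trans (partition_average_parent n x mv v0) _.
rewrite EFinM lee_wpmul2l ?lee_fin//; apply: nC; first by rewrite ltrBlDr ltrDl.
by rewrite CE; exact: cell_self fil _ _.
Qed.

End stopping.

(** * Almost everywhere domination by the maximal function *)

Lemma le_limn_einf (R : realType) (u : (\bar R)^nat) (c : \bar R) :
  (\forall n \near \oo, c <= u n) -> c <= limn_einf u.
Proof.
move=> [n _ cu]; rewrite limn_einf_lim.
apply: lime_ge; first exact: is_cvg_einfs.
exists n => // k /= nk; apply: le_ereal_inf_tmp => _ [j /= kj <-].
exact/cu/(leq_trans nk).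
Qed.

Lemma limn_einf_le (R : realType) (u : (\bar R)^nat) (c : \bar R) :
  (forall n, u n <= c) -> limn_einf u <= c.
Proof.
move=> uc; rewrite limn_einf_lim; apply: lime_le; first exact: is_cvg_einfs.
apply: nearW => n; apply: le_trans (uc n).
by apply: ereal_inf_lbound; exists n => //=.
Qed.

Section lebesgue.
Context d (T : measurableType d) (R : realType).
Variables (mu : {measure set T -> \bar R}) (LL : set (T -> R)).
Variables (CC : int -> set (set T)) (N0 : R).
Hypothesis fil : filtration_of_partitions mu CC LL N0.

(** On each cell of level [n] both integrands have the same integral. The bound is uniform in [n],
    as its use after Fatou's lemma requires. *)
Lemma integral_partition_average (h : T -> R) n :
  measurable_fun [set: T] h -> (forall x, (0 <= h x)%R) ->
  \int[mu]_x partition_average mu CC h n x <= \int[mu]_x (h x)%:E.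
Proof.
move=> mh h0; have [cov tI _] := fp_partition fil n.
rewrite -cov; apply: ge0_le_integral_bigcup => //.
- exact: fp_countable fil n.
- by move=> C; exact: (fp_measurable fil).
- exact: measurable_partition_average fil _ _.
- exact/measurable_EFinP.
- by move=> x; exact: average_ge0.
- move=> C CnC; have [x CE] := level_cell fil CnC; subst C.
  rewrite (integral_cellE fil).
  rewrite (eq_integral (cst (partition_average mu CC h n x))); last first.
    move=> y; rewrite inE => xy.
    by rewrite /partition_average (cell_eq fil CnC xy).
  by rewrite integral_cst//; exact: cell_measurable fil _ _.
Qed.

Lemma abse_partition_average_le (g u : T -> R) n x :
  measurable_fun [set: T] g -> measurable_fun [set: T] u ->
  `|partition_average mu CC g n x| <=
  partition_average mu CC (fun y => `|u y|%R) n x +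
  partition_average mu CC (fun y => `|u y - g y|%R) n x.
Proof.
move=> mg meas_u; have mC := cell_measurable fil n x.
have [c c0 cE] := cell_muE fil n x.
rewrite /partition_average /average abseM cE inver gt_eqF//=.
rewrite (ger0_norm (_ : 0 <= c^-1)%R) ?invr_ge0 ?(ltW c0)//.
rewrite -ge0_muleDl; try by apply: integral_ge0 => y _; rewrite lee_fin.
rewrite lee_wpmul2r ?lee_fin ?invr_ge0 ?(ltW c0)//.
have mu1 : measurable_fun (cell CC n x) (fun y => `|u y|%:E).
  apply/measurable_EFinP/measurable_funTS.
  exact: measurableT_comp (@normr_measurable R setT) meas_u.
have mug : measurable_fun (cell CC n x) (fun y => `|u y - g y|%:E).
  apply/measurable_EFinP/measurable_funTS.
  apply: measurableT_comp (@normr_measurable R setT) _.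
  exact: measurable_funB.
rewrite -ge0_integralD//.
apply: le_trans (le_abse_integral mu mC _) _.
  exact/measurable_EFinP/measurable_funTS.
apply: ge0_le_integral => //.
- apply: measurableT_comp => //; exact/measurable_EFinP/measurable_funTS.
- exact: emeasurable_funD.
- move=> y _; rewrite -EFinD lee_fin.
  by rewrite -[g y in leLHS](subKr (u y)) (le_trans (ler_normB _ _)).
Qed.

Lemma partition_average_le_maximal (u : T -> R) n x :
  partition_average mu CC (fun y => `|u y|%R) n x <= maximal mu CC u x.
Proof. by apply: ereal_sup_ubound; exists n. Qed.

Lemma maximal_ge0 (u : T -> R) x : 0 <= maximal mu CC u x.
Proof.
by apply: le_trans (partition_average_le_maximal u 0%R x); exact: average_ge0.
Qed.

Hypothesis dense : L1dense mu LL.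

(* For g in the dense class, u <= |g| + h with h := |u - g|, and |g| is the
   limit of averages dominated by those of u and h, so that
   u - Mu <= h + liminf_n h_n; Fatou bounds the integral of the latter. *)
Lemma maximal_gap_measure (f u : T -> R) A (a e : R) :
  measurable_fun [set: T] u -> f \in Lfun mu 1 ->
  (forall x, (`|f x| <= `|u x|)%R) ->
  measurable A -> (forall x, A x -> f x = u x) ->
  (forall x, A x -> maximal mu CC u x + a%:E <= `|u x|%:E) ->
  (0 < a)%R -> (0 < e)%R -> a%:E * mu A <= e%:E.
Proof.
move=> meas_u fL fu mA fA Aa a0 e0.
(* One half of [e] pays for the integral of [h], the other for that of the lower limit of its
   averages. *)
have e20 : (0 < e / 2)%R by rewrite divr_gt0.
have [LL1 dns] := dense.
have [g LLg] := dns _ fL _ e20.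
rewrite Lnorm1.
pose h x := `|f x - g x|%R; rewrite -[X in X < _]/(\int[mu]_x (h x)%:E) => he.
have mf : measurable_fun [set: T] f by have /sub_Lfun_mfun/set_mem := fL.
have mg : measurable_fun [set: T] g by have /sub_Lfun_mfun/set_mem := LL1 _ LLg.
have mh : measurable_fun [set: T] h.
  apply: measurableT_comp (@normr_measurable R setT) _.
  exact: measurable_funB.
have h0 x : (0 <= h x)%R by rewrite normr_ge0.
pose hn k x := partition_average mu CC h k%:Z x.
have mhn k : measurable_fun [set: T] (hn k).
  exact: measurable_partition_average fil _ _.
have hn0 k x : 0 <= hn k x by exact: average_ge0.
have linf0 x : 0 <= limn_einf (hn ^~ x).
  by apply: le_limn_einf; apply: nearW.
have mlinf : measurable_fun [set: T] (fun x => limn_einf (hn ^~ x)).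
  rewrite /limn_einf; apply: measurableT_comp => //.
  apply: (measurable_fun_limn_esup (f := fun k x => - hn k x)) => k.
  exact: measurableT_comp.
rewrite -(integral_cst mu mA).
apply: (@le_trans _ _ (\int[mu]_(x in A) ((h x)%:E + limn_einf (hn ^~ x)))).
  apply: ae_ge0_le_integral => //.
  - by move=> x _; rewrite lee_fin ltW.
  - by move=> x _; rewrite adde_ge0// lee_fin.
  - apply: emeasurable_funD; last exact: measurable_funTS.
    exact/measurable_EFinP/measurable_funTS.
  apply: filterS (fp_lebesgue fil LLg) => x gx Ax.
  have := Aa x Ax; have := maximal_ge0 u x.
  have Mle := partition_average_le_maximal u _ x.
  (* On [A] the maximal function is a real [r], since its sum with [a] is at most the real |u x|. *)
  case ME : (maximal mu CC u x) => [r||]// _; rewrite -EFinD lee_fin => rau.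
  have linf : (`|g x| - r)%:E <= limn_einf (hn ^~ x).
    apply/lee_addgt0Pr => t t0; rewrite -leeBlDr// -EFinB.
    apply: le_limn_einf.
    have tg : (`|g x| - t < `|g x|)%R by rewrite ltrBlDr ltrDl.
    have gx' : `|partition_average mu CC g k%:Z x| @[k --> \oo] --> `|g x|%:E.
      exact: cvg_abse gx.
    have : \forall k \near \oo,
        (`|g x| - t)%:E < `|partition_average mu CC g k%:Z x|.
      exact: gx' _ (@nbhs_open_ereal_gt R `|g x|%R (fun=> `|g x| - t)%R tg).
    apply: filterS => k /= tgk.
    have tgf := le_trans (ltW tgk) (abse_partition_average_le _ _ mg mf).
    have Mk : partition_average mu CC (fun y => `|f y|%R) k%:Z x <= r%:E.
      rewrite -ME; apply: le_trans (Mle k%:Z).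
      rewrite lee_wpmul2r ?inve_ge0//; apply: ge0_le_integral => //.
      - exact: cell_measurable fil _ _.
      - apply/measurable_EFinP/measurable_funTS.
        exact: measurableT_comp (@normr_measurable R setT) mf.
      - apply/measurable_EFinP/measurable_funTS.
        exact: measurableT_comp (@normr_measurable R setT) meas_u.
      - by move=> y _; rewrite lee_fin.
    rewrite addrAC EFinB leeBlDl//.
    exact: le_trans tgf (leeD2r _ Mk).
  apply: le_trans (leeD2l _ linf).
  rewrite -EFinD lee_fin /h.
  have : (`|u x| <= `|f x - g x| + `|g x|)%R.
    by rewrite -(fA x Ax) -[X in (`|X| <= _)%R](subrK (g x)) ler_normD.
  lra.
apply: (@le_trans _ _ (\int[mu]_x ((h x)%:E + limn_einf (hn ^~ x)))).
  apply: ge0_subset_integral => //.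
    by apply: emeasurable_funD => //; exact/measurable_EFinP.
  by move=> x _; rewrite adde_ge0// lee_fin.
rewrite ge0_integralD//; first last.
- exact/measurable_EFinP.
- by move=> x _; rewrite lee_fin.
rewrite (splitr e) EFinD leeD ?(ltW he)//.
apply: le_trans (fatou mu measurableT mhn (fun n x _ => hn0 n x)) _.
apply: limn_einf_le => n; apply: le_trans (ltW he).
exact: integral_partition_average.
Qed.

(** The exceptional set is covered by countably many sets, indexed by the cells [C] of level 0 and
    the gaps 1/(j+1). To each of them [maximal_gap_measure] applies with f = u 1_C and every e > 0,
    so each is null. *)
Lemma ae_le_maximal (u : T -> R) : L1loc mu u ->
  {ae mu, forall x, `|u x|%:E <= maximal mu CC u x}.
Proof.
move=> uloc; have meas_u := measurable_L1loc fil uloc.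
have null C (j : nat) : CC 0%R C -> mu.-negligible
    (C `&` [set x | maximal mu CC u x + j.+1%:R^-1%:E <= `|u x|%:E]).
  move=> CC0.
  set A := _ `&` _.
  have mC : measurable C by exact: fp_measurable fil _ _ CC0.
  have mA : measurable A.
    apply: measurable_lee => //.
      apply: emeasurable_funD => //.
      by apply: measurable_funTS; exact: measurable_maximal fil _.
    apply/measurable_EFinP/measurable_funTS.
    exact: measurableT_comp (@normr_measurable R setT) meas_u.
  exists A; split=> //.
  have fL := uloc C mC (fp_finite fil CC0).
  have j0 : (0 < j.+1%:R^-1 :> R)%R by rewrite invr_gt0.
  have gap e : (0 < e)%R -> j.+1%:R^-1%:E * mu A <= e%:E.
    apply: maximal_gap_measure meas_u fL _ mA _ _ j0.
    - move=> x /=; rewrite indicE normrM ler_piMr//.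
      by case: (x \in C); rewrite ?normr1 ?normr0.
    - by move=> x [Cx _] /=; rewrite indicE mem_set// mulr1.
    - by move=> x [].
  apply/eqP; rewrite eq_le measure_ge0 andbT.
  rewrite -(@lee_pmul2l _ j.+1%:R^-1%:E)// ?lte_fin// mule0.
  by apply/lee_addgt0Pr => e e0; rewrite add0e; exact: gap.
have [F [FE FP _]] := countable_bigcup_enum id (fp_countable fil 0%R).
have [cov _ _] := fp_partition fil 0%R.
suff gap_null : mu.-negligible (\bigcup_i \bigcup_j
    (F i `&` [set x | maximal mu CC u x + j.+1%:R^-1%:E <= `|u x|%:E])).
  apply: negligibleS gap_null => x /= /negP; rewrite -ltNge => Mu.
  have : [set: T] x by [].
  rewrite -cov /cover -FE => -[i _ Fx]; exists i => //.
  move: Mu (maximal_ge0 u x).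
  case ME : (maximal mu CC u x) => [r||]//; rewrite lte_fin => ru _.
  have ur0 : (0 < `|u x| - r)%R by rewrite subr_gt0.
  exists (Num.truncn (`|u x| - r)^-1) => //; split=> //=.
  rewrite ME -EFinD lee_fin -lerBrDl invf_ple ?posrE//.
  by rewrite ltW// truncnS_gt.
apply: negligible_bigcup => i; apply: negligible_bigcup => j.
have [->|[C C0 ->]] := FP i; last exact: null.
by rewrite set0I; exact: negligible_set0.
Qed.

End lebesgue.

(** * Chebyshev-type lower bounds *)

Section integral_ge_cst.
Import HBNNSimple.

(** The simple function k 1_A lies below the restriction of [G] to [C], and the integral is a
    supremum over such functions. [G] is arbitrary so that the inner integral of [oscillation] can
    take its place directly. *)
Lemma integral_ge_cst d (T : measurableType d) (R : realType)
    (mu : {measure set T -> \bar R}) (C A : set T) (G : T -> \bar R) (k : R) :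
  measurable A -> A `<=` C -> (0 <= k)%R ->
  (forall x, C x -> 0 <= G x) -> (forall x, A x -> k%:E <= G x) ->
  k%:E * mu A <= \int[mu]_(x in C) G x.
Proof.
move=> mA AC k0 G0 kG.
rewrite integral_mkcond ge0_integralTE; last first.
  by move=> x; apply: erestrict_ge0.
apply: ereal_sup_ubound => /=.
exists (scale_nnsfun (indic_nnsfun R mA) k0).
  move=> x /=; rewrite patchE mindicE.
  case: (boolP (x \in A)) => [/set_mem xA|xA].
    by rewrite mem_set ?mulr1 ?kG//; exact: AC.
  rewrite mulr0; case: ifPn => // /set_mem; exact: G0.
rewrite -integralT_nnsfun/=.
under eq_integral do rewrite EFinM.
rewrite ge0_integralZl_EFin//.
- by rewrite integral_indic// setIT.
- by move=> x _; rewrite lee_fin.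
- exact/measurable_EFinP.
Qed.

End integral_ge_cst.

Lemma measure_subset_EFin d (T : measurableType d) (R : realType)
    (mu : {measure set T -> \bar R}) (A C : set T) (c : R) :
  measurable A -> measurable C -> A `<=` C -> mu C = c%:E ->
  exists2 a : R, (0 <= a)%R & mu A = a%:E.
Proof.
move=> mA mC AC muC; have muA : mu A <= c%:E by rewrite -muC le_measure ?inE.
have muA_fin : mu A \is a fin_num.
  by rewrite ge0_fin_numE// (le_lt_trans muA) ?ltry.
by exists (fine (mu A)); rewrite ?fine_ge0// fineK.
Qed.

Lemma measurable_level_set d (T : measurableType d) (R : realType)
    (C : set T) (v : T -> R) (l : R) :
  measurable C -> measurable_fun [set: T] v ->
  measurable (C `&` [set x | (l < v x)%R]).
Proof.
move=> mC mv; have mv' : measurable_fun C (EFin \o v).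
  exact/measurable_EFinP/measurable_funTS.
exact: (emeasurable_fun_o_infty mC mv' l%:E).
Qed.

Lemma measure_level_set_le d (T : measurableType d) (R : realType)
    (mu : {measure set T -> \bar R}) (C : set T) (v : T -> R) (l : R) :
  measurable C -> measurable_fun [set: T] v -> (0 <= l)%R ->
  (forall x, (0 <= v x)%R) ->
  l%:E * mu (C `&` [set x | (l < v x)%R]) <= \int[mu]_(x in C) (v x)%:E.
Proof.
move=> mC mv l0 v0; apply: integral_ge_cst => //.
- exact: measurable_level_set.
- by move=> x _; rewrite lee_fin.
- by move=> x [_ /ltW]; rewrite lee_fin.
Qed.

(** * Oscillation on a cell with small average *)

Section level_sets.
Context d (T : measurableType d) (R : realType).
Variables (mu : {measure set T -> \bar R}) (LL : set (T -> R)).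
Variables (CC : int -> set (set T)) (N0 : R).
Hypothesis fil : filtration_of_partitions mu CC LL N0.
Variables (u : T -> R) (g : R).
Hypotheses (meas_u : measurable_fun [set: T] u) (g0 : (0 < g)%R).

Let v x := `|u x|%R.

Let mv : measurable_fun [set: T] v.
Proof. exact: measurableT_comp (@normr_measurable R setT) meas_u. Qed.

(** In the constant, 2 comes from |B| >= |C|/2, where [B] is the part of [C] with v <= l/2, and 2^g
    from |u z - u y| >= l/2 for y in [A] and z in [B]. *)
Lemma oscillation_ge n x (l : R) : (0 < l)%R ->
  partition_average mu CC v n x <= (l / 4)%:E ->
  mu (cell CC n x `&` [set y | (l < v y)%R]) * (l `^ g)%:E <=
  (2 * 2 `^ g)%:E * oscillation mu g u (cell CC n x) * mu (cell CC n x).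
Proof.
move=> l0 avg_le; set C := cell CC n x.
have mC : measurable C by exact: cell_measurable fil _ _.
have [c c0 cE] : exists2 c : R, (0 < c)%R & mu C = c%:E := cell_muE fil n x.
set A := _ `&` _.
have mA : measurable A by exact: measurable_level_set.
pose B' := C `&` [set y | (l / 2 < v y)%R].
have mB' : measurable B' by exact: measurable_level_set.
pose B := C `\` B'.
have mB : measurable B by exact: measurableD.
have [a a0 aE] := measure_subset_EFin mA mC (@subIsetl _ _ _) cE.
have [b b0 bE] := measure_subset_EFin mB mC (@subDsetl _ _ _) cE.
have [b' b'0 b'E] := measure_subset_EFin mB' mC (@subIsetl _ _ _) cE.
have l20 : (0 < l / 2)%R by rewrite divr_gt0.
(* Chebyshev's inequality at height l/2, with average at most l/4, leaves at most half of [C] to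
   [B']. *)
have bc : (c / 2 <= b)%R.
  have bb'c : (b + b' = c)%R.
    apply: EFin_inj; rewrite EFinD -bE -b'E -cE addeC.
    rewrite -measureU//; last exact: setDIK.
    by rewrite setDUK//; exact: subIsetl.
  have : (l / 2)%:E * mu B' <= \int[mu]_(y in C) (v y)%:E.
    apply: measure_level_set_le => //; first exact: ltW.
    by move=> y; exact: normr_ge0.
  rewrite (integral_cellE fil) -/C cE b'E => /le_trans lb.
  have lb' : (l / 2 * b' <= l / 4 * c)%R.
    rewrite -lee_fin !EFinM; apply: lb.
    by rewrite lee_wpmul2r// lee_fin ltW.
  have : (b' <= c / 2)%R by rewrite -(ler_pM2l l20); apply: le_trans lb' _; lra.
  lra.
have lg0 : (0 <= (l / 2) `^ g)%R by exact: powR_ge0.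
have kB0 : (0 <= (l / 2) `^ g * b)%R by rewrite mulr_ge0.
have inner y : A y ->
    ((l / 2) `^ g * b)%:E <= \int[mu]_(z in C) (`|u z - u y| `^ g)%:E.
  move=> [Cy /= ly]; rewrite EFinM -bE; apply: integral_ge_cst => //.
    exact: subDsetl.
  move=> z [Cz Bz] /=.
  rewrite lee_fin ge0_ler_powR ?nnegrE ?(ltW g0) ?(ltW l20)//.
  have vz : (v z <= l / 2)%R.
    by rewrite leNgt; apply/negP => lz; apply: Bz.
  rewrite distrC; apply: le_trans (lerB_dist _ _).
  by move: ly vz; rewrite /v; lra.
have outer : ((l / 2) `^ g * b)%:E * mu A <=
    \int[mu]_(y in C) \int[mu]_(z in C) (`|u z - u y| `^ g)%:E.
  apply: integral_ge_cst => //; first exact: subIsetl.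
  by move=> y _; apply: integral_ge0 => z _; rewrite lee_fin powR_ge0.
(* One factor of |C|^2 cancels against the outer [mu C]. *)
have oscE : oscillation mu g u C * mu C =
    c^-1%:E * \int[mu]_(y in C) \int[mu]_(z in C) (`|u z - u y| `^ g)%:E.
  have c20 : (c * c)%R != 0%R by rewrite mulf_neq0 ?gt_eqF.
  rewrite /oscillation cE [c%:E ^+ 2]expe2 -EFinM inver (negbTE c20).
  rewrite muleAC -EFinM; congr (_%:E * _).
  by rewrite invfM mulfVK ?gt_eqF.
rewrite -muleA oscE muleA -EFinM.
apply: le_trans (_ :
  (2 * 2 `^ g * c^-1)%:E * (((l / 2) `^ g * b)%:E * mu A) <= _).
  rewrite aE -!EFinM lee_fin.
  have -> : (l `^ g = 2 `^ g * (l / 2) `^ g)%R.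
    by rewrite -powRM ?(ltW l20)// mulrC divfK.
  set k := (2 `^ g)%R; set k' := ((l / 2) `^ g)%R.
  have kk' : (0 <= a * (k * k'))%R by rewrite !mulr_ge0 ?powR_ge0.
  have -> : (2 * k * c^-1 * (k' * b * a) = (a * (k * k')) * (2 * b / c))%R.
    by ring.
  by rewrite ler_peMr// ler_pdivlMr// mul1r; lra.
by rewrite lee_wpmul2l// lee_fin !mulr_ge0 ?powR_ge0// invr_ge0 ltW.
Qed.

End level_sets.

(** * Auxiliary facts on powers and indicators *)

(** [M] will be a value of the maximal function, possibly +oo; then the right-hand side is +oo too,
    because 1 - 2^(-q) > 0. *)
Lemma dyadic_sum_le_poweR (R : realType) (q a : R) (M : \bar R) N :
  (0 < q)%R -> (0 < a)%R -> 0 <= M ->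
  (\sum_(j < N) (a / 2 ^+ j.+1) `^ q * ((a / 2 ^+ j.+1)%:E < M)%E%:R)%:E
  <= (1 - 2^-1 `^ q)^-1%:E * M `^ q.
Proof.
move=> q0 a0; case: M => [r||]//; last first.
  move=> _; rewrite poweRyr ?gt_eqF// gt0_muley ?leey//.
  rewrite lte_fin invr_gt0 subr_gt0.
  exact: powR_half_lt1.
rewrite lee_fin => r0; rewrite poweR_EFin -EFinM lee_fin mulrC.
exact: dyadic_sum_le_powR.
Qed.

Lemma mul_indic_patch T (R : realType) (A : set T) (f : T -> \bar R) x :
  f x * (\1_A x)%:E = (f \_ A) x.
Proof.
by rewrite indicE patchE; case: ifPn => _; rewrite ?mule1 ?mule0.
Qed.

Lemma powR_div (R : realType) (x y r : R) : (0 <= x)%R -> (0 <= y)%R ->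
  ((x / y) `^ r = x `^ r / y `^ r)%R.
Proof.
move=> x0 y0; rewrite powRM ?invr_ge0// -(powR_inv1 y0) -powRrM mulN1r.
by rewrite powRN.
Qed.

(** * The good-lambda inequality *)

Section good_lambda.
Context d (T : measurableType d) (R : realType).
Variables (mu : {measure set T -> \bar R}) (LL : set (T -> R)).
Variables (CC : int -> set (set T)) (N0 : R).
Hypothesis fil : filtration_of_partitions mu CC LL N0.
Variables (u : T -> R) (g : R) (m : int).
Hypotheses (meas_u : measurable_fun [set: T] u) (g0 : (0 < g)%R).

Let v x := `|u x|%R.

Let mv : measurable_fun [set: T] v.
Proof. exact: measurableT_comp (@normr_measurable R setT) meas_u. Qed.

(** The integrand F of J before the power p. *)
Definition sharp_maximal x : \bar R :=
  sharp mu CC g m u x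
  + maximal_le mu CC m (fun y => `|u y| `^ g)%R x `^ g^-1.

Lemma oscillation_ge0 C : 0 <= oscillation mu g u C.
Proof.
rewrite mule_ge0//; first by rewrite inve_ge0 expe_ge0.
apply: integral_ge0 => y _; apply: integral_ge0 => z _.
by rewrite lee_fin powR_ge0.
Qed.

Lemma sharp_ge0 x : 0 <= sharp mu CC g m u x.
Proof.
apply: le_trans (_ : oscillation mu g u (cell CC m x) `^ g^-1 <= _).
  exact: poweR_ge0.
apply: le_trans (ereal_sup_ubound _); last by exists m => /=.
apply: ereal_sup_ubound; exists (cell CC m x) => //; exact: cellP fil m x.
Qed.

Lemma measurable_sharp_maximal : measurable_fun [set: T] sharp_maximal.
Proof.
apply: emeasurable_funD; first exact: measurable_sharp fil _ _ _.
apply: measurableT_comp (measurable_poweR _) _.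
exact: measurable_maximal_le fil _ _.
Qed.

Let le_poweR (x y : \bar R) (r : R) : (0 <= r)%R -> 0 <= x -> x <= y ->
  x `^ r <= y `^ r.
Proof.
move=> r0 x0 xy.
by apply: gt0_ler_poweR => //; rewrite in_itv/= ?x0 leey ?(le_trans x0).
Qed.

(** Serves the levels from [m] on, through the first summand of F. *)
Lemma oscillation_le_sharp_maximal n x : (m <= n)%R ->
  oscillation mu g u (cell CC n x) <= sharp_maximal x `^ g.
Proof.
move=> mn; rewrite -[leLHS]poweRe1 ?oscillation_ge0//.
rewrite -[in leLHS](mulVf (lt0r_neq0 g0)) poweRrM.
rewrite le_poweR ?poweR_ge0 ?(ltW g0)//.
apply: le_trans (leeDl _ (poweR_ge0 _ _)).
apply: le_trans (ereal_sup_ubound _); last by exists n => /=.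
apply: ereal_sup_ubound; exists (cell CC n x) => //; exact: cellP fil n x.
Qed.

(** Serves the levels up to [m], through the second summand of F. *)
Lemma partition_average_le_sharp_maximal n x : (n <= m)%R ->
  partition_average mu CC (fun y => `|u y| `^ g)%R n x <= sharp_maximal x `^ g.
Proof.
move=> nm.
have avg0 : 0 <= partition_average mu CC (fun y => `|u y| `^ g)%R n x.
  by apply: average_ge0 => y; exact: powR_ge0.
rewrite -[leLHS]poweRe1//.
rewrite -[in leLHS](mulVf (lt0r_neq0 g0)) poweRrM.
rewrite le_poweR ?poweR_ge0 ?(ltW g0)//.
apply: le_trans (leeDr _ (sharp_ge0 x)).
rewrite le_poweR ?invr_ge0 ?(ltW g0)//.
by apply: ereal_sup_ubound; exists n.
Qed.

(** A cell has positive finite measure and lies in its parent, whose measure is at most [N0] times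
    as large. *)
Lemma regularity_ge1 : (1 <= N0)%R.
Proof.
have [c c0 cE] := cell_muE fil 0%R point.
rewrite -(ler_pM2r c0) mul1r -lee_fin EFinM -cE.
apply: le_trans (cell_parent fil 0%R point); apply: le_measure.
- by rewrite inE; exact: cell_measurable fil _ _.
- by rewrite inE; exact: cell_measurable fil _ _.
- exact: (cell_nested fil).
Qed.

(** The height l / (4 N0) makes the average over [C] at most l/4 after the loss of [N0]. Levels from
    [m] on use [oscillation_ge], lower ones Chebyshev's inequality for v^g. *)
Lemma stopping_level_set_le (l : R) C x : (0 < l)%R ->
  stopping mu CC v (l / (4 * N0)) C -> C x ->
  mu (C `&` [set y | (l < v y)%R]) * (l `^ g)%:E <=
  (2 * 2 `^ g)%:E * sharp_maximal x `^ g * mu C.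
Proof.
move=> l0 stC Cx; have N00 := lt_le_trans ltr01 regularity_ge1.
have avgC := stopping_average_le fil mv (fun y => normr_ge0 _) (ltW N00) stC.
have {}avgC : average mu v C <= (l / 4)%:E.
  by move: avgC; have -> : (N0 * (l / (4 * N0)) = l / 4)%R by field; lra.
have [n [CnC _ _]] := stC.
move: avgC; rewrite -(cell_eq fil CnC Cx) => avgC.
have mC := cell_measurable fil n x.
have [mn|nm] := leP m n.
  apply: le_trans (oscillation_ge fil meas_u g0 l0 avgC) _.
  rewrite lee_wpmul2r// lee_wpmul2l ?lee_fin ?mulr_ge0 ?powR_ge0//.
  exact: oscillation_le_sharp_maximal.
have lg : (l `^ g)%:E * mu (cell CC n x `&` [set y | (l < v y)%R]) <=
    \int[mu]_(y in cell CC n x) (v y `^ g)%:E.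
  apply: integral_ge_cst.
  - exact: measurable_level_set.
  - exact: subIsetl.
  - exact: powR_ge0.
  - by move=> y _; rewrite lee_fin powR_ge0.
  - move=> y [_ /= ly].
    rewrite lee_fin ge0_ler_powR ?nnegrE ?(ltW g0) ?(ltW l0)//.
      by rewrite normr_ge0.
    exact: ltW.
rewrite muleC; apply: le_trans lg _; rewrite (integral_cellE fil).
rewrite lee_wpmul2r//.
apply: le_trans (partition_average_le_sharp_maximal _ (ltW nm)) _.
(* Chebyshev's inequality gives the constant 1, which is below the common constant 2 2^g. *)
rewrite lee_pemull ?poweR_ge0// lee_fin.
have : (1 <= 2 `^ g)%R.
  have := @ler_powR R 2%R _ 0%R g (ltW g0).
  by rewrite powRr0; apply; rewrite ler1n.
lra.
Qed.

Variables (chi : {measure set T -> \bar R}) (beta Nw : R).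
Hypotheses (b0 : (0 < beta)%R) (chi_beta : beta_type mu CC beta Nw chi).

Lemma beta_type_ge0 : (0 <= Nw)%R.
Proof.
have [c c0 cE] := cell_muE fil 0%R point.
have mC := cell_measurable fil 0%R point.
have Cin : (\bigcup_n CC n) (cell CC 0%R point).
  by exists 0%R => //; exact: cell_level fil _ _.
have [_ /(_ _ mC (@subset_refl _ _))] := chi_beta Cin.
rewrite cE poweR_EFin inver gt_eqF ?powR_gt0// -!EFinM.
rewrite divff ?gt_eqF ?powR_gt0// mulr1 => le_Nw.
by rewrite -lee_fin; apply: le_trans le_Nw; rewrite mule_ge0 ?inve_ge0.
Qed.

(** The constant of [stopping_level_set_le] to the power [beta], times that of the [beta_type]
    condition. *)
Let K : R := (Nw * (2 * 2 `^ g) `^ beta)%R.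

(** The bound on |A|/|C| holds at every point of [C], so its power [beta] can be integrated over [C]
    with respect to [chi]. *)
Lemma stopping_weight_le (l : R) C : (0 < l)%R ->
  stopping mu CC v (l / (4 * N0)) C ->
  chi (C `&` [set y | (l < v y)%R]) <=
  \int[chi]_(x in C) ((K / l `^ (g * beta))%:E * sharp_maximal x `^ (g * beta)).
Proof.
move=> l0 stC; have [n [CnC _ _]] := stC.
have [y CE] := level_cell fil CnC.
have mC : measurable C by exact: fp_measurable fil _ _ CnC.
have [c c0 cE] : exists2 c : R, (0 < c)%R & mu C = c%:E.
  by rewrite CE; exact: cell_muE fil n y.
have [chiC_lty chi_le] := chi_beta (stopping_level stC).
set A := _ `&` _.
have mA : measurable A by exact: measurable_level_set.
have AC : A `<=` C by exact: subIsetl.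
have [a a0 aE] := measure_subset_EFin mA mC AC cE.
have Nw0 := beta_type_ge0.
have chiA : chi A <= (Nw * (a / c) `^ beta)%:E * chi C.
  (* If chi C = 0 one cannot multiply back by chi C, but then chi A = 0 by monotonicity. *)
  have [chiC0|chiC0] := eqVneq (chi C) 0.
    by rewrite chiC0 mule0 -chiC0 le_measure ?inE.
  have := chi_le _ mA AC; rewrite aE cE !poweR_EFin inver gt_eqF ?powR_gt0//.
  rewrite -!EFinM -powR_div ?(ltW c0)// => chiAC.
  have chiC_fin : chi C \is a fin_num by rewrite ge0_fin_numE.
  have chiC_gt0 : (0 < fine (chi C))%R.
    by rewrite fine_gt0// chiC_lty lt0e chiC0 measure_ge0.
  rewrite -(fineK chiC_fin) -lee_pdivrMr//.
  by move: chiAC; rewrite -(fineK chiC_fin) inver gt_eqF.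
apply: le_trans chiA _; rewrite -integral_cst//.
apply: ge0_le_integral => //.
- by move=> x _; rewrite lee_fin mulr_ge0 ?powR_ge0.
- apply: measurable_funTS; apply: measurable_funeM.
  exact: measurableT_comp (measurable_poweR _) measurable_sharp_maximal.
- move=> x Cx /=.
  have := stopping_level_set_le l0 stC Cx; rewrite -/A aE cE.
  have lg0 : (0 < l `^ g)%R by rewrite powR_gt0.
  move=> acF.
  have {}acF : (a / c)%:E <= (2 * 2 `^ g / l `^ g)%:E * sharp_maximal x `^ g.
    rewrite -(@lee_pmul2r _ (c * l `^ g)%:E)// ?lte_fin ?mulr_gt0//.
    rewrite [leRHS]muleAC -!EFinM mulrA divfK ?gt_eqF//.
    have -> : (2 * 2 `^ g / l `^ g * (c * l `^ g) = 2 * 2 `^ g * c)%R.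
      by field; rewrite gt_eqF.
    by move: acF; rewrite [leRHS]muleAC -!EFinM.
  rewrite /K -!mulrA EFinM [in leRHS]EFinM -muleA lee_wpmul2l ?lee_fin//.
  have := le_poweR (ltW b0) _ acF; rewrite lee_fin divr_ge0 ?(ltW c0)//.
  move=> /(_ isT); rewrite poweR_EFin => /le_trans; apply.
  rewrite poweRM ?poweR_ge0 ?lee_fin ?divr_ge0 ?mulr_ge0 ?powR_ge0//.
  by rewrite poweR_EFin -poweRrM powR_div ?mulr_ge0 ?powR_ge0// -powRrM.
Qed.

Hypotheses (dense : L1dense mu LL) (uloc : L1loc mu u).
Hypothesis u_to0 : forall x,
  partition_average mu CC v (- k%:Z)%R x @[k --> \oo] --> 0.
Hypothesis chi_ac : forall A, measurable A -> mu A = 0 -> chi A = 0.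

Let mM : measurable_fun [set: T] (maximal mu CC u).
Proof. exact: measurable_maximal fil _. Qed.

Let mF r : measurable_fun [set: T] (fun x => sharp_maximal x `^ r).
Proof.
exact: measurableT_comp (measurable_poweR _) measurable_sharp_maximal.
Qed.

(** [stopping_weight_le] is summed over the disjoint stopping cells, which cover the level set up to
    a null set. *)
Lemma level_weight_le (l : R) : (0 < l)%R ->
  chi [set x | (l < v x)%R] <=
  \int[chi]_(x in [set x | (l / (4 * N0))%:E < maximal mu CC u x])
    ((K / l `^ (g * beta))%:E * sharp_maximal x `^ (g * beta)).
Proof.
move=> l0; set l' := (l / (4 * N0))%R; have N01 := regularity_ge1.
have N00 := lt_le_trans ltr01 N01.
have l'0 : (0 < l')%R by rewrite divr_gt0// mulr_gt0.
have K0 : (0 <= K)%R by rewrite mulr_ge0 ?beta_type_ge0 ?powR_ge0.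
set G := fun x => (K / l `^ (g * beta))%:E * sharp_maximal x `^ (g * beta).
have G0 x : 0 <= G x.
  by rewrite mule_ge0 ?poweR_ge0// lee_fin divr_ge0 ?powR_ge0.
have mG : measurable_fun [set: T] G by exact: measurable_funeM.
pose E := [set x | (l < v x)%R].
have mE : measurable E.
  by have := measurable_level_set l measurableT mv; rewrite setTI.
set D := [set x | l'%:E < maximal mu CC u x].
have mD : measurable D.
  by have := emeasurable_fun_o_infty measurableT mM l'%:E; rewrite setTI.
pose U := \bigcup_(C in stopping mu CC v l') C.
have cU : countable (stopping mu CC v l') by exact: stopping_countable fil _ _.
have mU : measurable U.
  apply: countable_bigcup_measurable => // C.
  exact: stopping_measurable fil _ _ _.
(* The average over a stopping cell is among those defining the maximal function at each of its
   points. *)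
have UD : U `<=` D.
  move=> x [C [n [CnC lC _]] Cx]; apply/ereal_sup_gtP.
  exists (average mu v C) => //; exists n => //.
  by rewrite /partition_average (cell_eq fil CnC Cx).
have [N [mN muN subN]] := ae_le_maximal fil dense uloc.
apply: (@le_trans _ _ (chi (E `&` U))).
  have EUN : E `<=` (E `&` U) `|` N.
    move=> x Ex; have [vM|nvM] := pselect (`|u x|%:E <= maximal mu CC u x).
      left; split=> //; apply: (stopping_cover fil l'0 (u_to0 x)).
      rewrite -/(maximal mu CC u x); apply: lt_le_trans vM; rewrite lte_fin.
      apply: le_lt_trans Ex; rewrite /l' ler_pdivrMr ?mulr_gt0//.
      by rewrite ler_peMr ?ltW//; lra.
    by right; apply: subN.
  have mEU : measurable (E `&` U) by exact: measurableI.
  (* [N] is null for [mu], hence for [chi] by absolute continuity. *)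
  have <- : chi (E `&` U `|` N) = chi (E `&` U).
    by apply: measureU0 => //; exact: chi_ac.
  by rewrite le_measure ?inE//; exact: measurableU.
apply: le_trans (ge0_subset_integral chi mU mD (measurable_funTS mG)
  (fun x _ => G0 x) UD).
have -> : chi (E `&` U) = \int[chi]_(x in U) (\1_E x)%:E.
  by rewrite integral_indic.
apply: ge0_le_integral_bigcup => //.
- exact: (stopping_trivIset fil).
- by move=> C; exact: stopping_measurable fil _ _ _.
- exact/measurable_EFinP.
- move=> C stC; have mC := stopping_measurable fil stC.
  by rewrite integral_indic// setIC; exact: stopping_weight_le.
Qed.

(** * Summation over dyadic levels *)

Variable p : R.
Hypothesis gbp : (g * beta < p)%R.

Let gb0 : (0 < g * beta)%R. Proof. by rewrite mulr_gt0. Qed.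
Let q0 : (0 < p - g * beta)%R. Proof. by rewrite subr_gt0. Qed.
Let p0 : (0 < p)%R. Proof. exact: lt_trans gb0 gbp. Qed.

(** [K] comes from the good-lambda bound, 2^p from v <= 2 l on a dyadic layer, the power of 4 N0
    from changing l into l / (4 N0), and the denominator from a geometric series. *)
Definition good_lambda_cst : R :=
  (K * 2 `^ p * (4 * N0) `^ (p - g * beta) / (1 - 2^-1 `^ (p - g * beta)))%R.

Let c1 : R := (K * 2 `^ p * (4 * N0) `^ (p - g * beta))%R.

Let c1_ge0 : (0 <= c1)%R.
Proof. by rewrite !mulr_ge0 ?powR_ge0 ?beta_type_ge0. Qed.

Lemma good_lambda_cst_ge0 : (0 <= good_lambda_cst)%R.
Proof.
rewrite /good_lambda_cst -/c1 divr_ge0//.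
by rewrite subr_ge0 ltW// powR_half_lt1.
Qed.

Let D (l : R) := [set x | l%:E < maximal mu CC u x].

Let mD l : measurable (D l).
Proof.
by have := emeasurable_fun_o_infty measurableT mM l%:E; rewrite setTI.
Qed.

(** As l^p l^(- g beta) = l^(p - g beta), the weight becomes a power of l / (4 N0), the height at
    which the maximal function is cut. This is the form summed by [dyadic_sum_le_poweR]. *)
Lemma level_weight_scaled_le (l : R) : (0 < l)%R ->
  ((2 * l) `^ p)%:E * chi [set x | (l < v x)%R] <=
  \int[chi]_x (c1%:E * (sharp_maximal x `^ (g * beta) *
    ((l / (4 * N0)) `^ (p - g * beta) * \1_(D (l / (4 * N0))) x)%:E)).
Proof.
move=> l0; have N01 := regularity_ge1; have N00 := lt_le_trans ltr01 N01.
apply: le_trans (lee_wpmul2l _ (level_weight_le l0)) _.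
  by rewrite lee_fin powR_ge0.
have K0 : (0 <= K)%R by rewrite mulr_ge0 ?beta_type_ge0 ?powR_ge0.
have mDl := mD (l / (4 * N0)).
rewrite -/(D _) -ge0_integralZl_EFin ?powR_ge0//; first last.
- by apply: measurable_funTS; exact: measurable_funeM.
- by move=> x _; rewrite mule_ge0 ?poweR_ge0// lee_fin divr_ge0 ?powR_ge0.
rewrite integral_mkcond le_eqVlt; apply/orP; left; apply/eqP.
apply: eq_integral => x _; rewrite -mul_indic_patch.
set W := sharp_maximal x `^ _; set i := \1_ _ x.
rewrite muleA -EFinM [_%:E * W]muleC -muleA -EFinM [RHS]muleCA -EFinM.
congr (_ * _%:E); rewrite [RHS]mulrA; congr (_ * _)%R.
rewrite /c1 powRM ?(ltW l0)// powR_div ?(ltW l0) ?mulr_ge0 ?(ltW N00)//.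
rewrite (@powRB _ l) ?gt_eqF ?implybT//.
have lgb0 : (l `^ (g * beta) != 0)%R by rewrite gt_eqF ?powR_gt0.
have N0q0 : ((4 * N0) `^ (p - g * beta) != 0)%R.
  by rewrite gt_eqF ?powR_gt0 ?mulr_gt0.
by field; apply/andP; split.
Qed.

Let mv_gt l : measurable [set x | (l < v x)%R].
Proof. by have := measurable_level_set l measurableT mv; rewrite setTI. Qed.

(* The lower bound is 2^-n, in the form required by powR_le_dyadic_sum. *)
Let shell n := [set x | (v x <= 2 ^+ n)%R /\ (2 ^+ n / 2 ^+ n.*2 < v x)%R].

Let mshell n : measurable (shell n).
Proof.
have -> : shell n = [set x | (2 ^+ n / 2 ^+ n.*2 < v x)%R] `\`
    [set x | (2 ^+ n < v x)%R].
  apply/seteqP; split=> x [].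
    by rewrite leNgt => /negP.
  by move=> ? /negP; rewrite -leNgt.
exact: measurableD.
Qed.

(** On a shell the 2n dyadic levels from 2^(n-1) down to 2^(-n) suffice, so only finite sums are
    exchanged with integrals. The constant is independent of [n]. *)
Lemma shell_integral_le n :
  \int[chi]_x ((v x `^ p)%:E * (\1_(shell n) x)%:E) <=
  good_lambda_cst%:E *
  \int[chi]_x
    (maximal mu CC u x `^ (p - g * beta) * sharp_maximal x `^ (g * beta)).
Proof.
have N01 := regularity_ge1; have N00 := lt_le_trans ltr01 N01.
pose l (j : nat) : R := (2 ^+ n / 2 ^+ j.+1)%R.
have l0 j : (0 < l j)%R by rewrite divr_gt0 ?exprn_gt0.
pose W x := sharp_maximal x `^ (g * beta).
have W0 x : 0 <= W x by exact: poweR_ge0.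
have mW : measurable_fun [set: T] W by exact: mF.
pose l' j := (l j / (4 * N0))%R.
pose H j x := (l' j `^ (p - g * beta) * \1_(D (l' j)) x)%:E.
have H0 j x : 0 <= H j x by rewrite lee_fin mulr_ge0 ?powR_ge0.
have mH j : measurable_fun [set: T] (H j).
  by apply/measurable_EFinP; exact: measurable_funM.
have mvp : measurable_fun [set: T] (fun x => (v x `^ p)%:E).
  by apply/measurable_EFinP; exact: measurableT_comp (measurable_powR p) mv.
have cst0 := good_lambda_cst_ge0.
apply: (@le_trans _ _ (\int[chi]_x \sum_(j < n.*2)
    (((2 * l j) `^ p)%:E * (\1_[set x | (l j < v x)%R] x)%:E))).
  apply: ge0_le_integral => //.
  - by move=> x _; rewrite mule_ge0// lee_fin ?powR_ge0.
  - by apply: emeasurable_funM => //; apply/measurable_EFinP.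
  - apply: emeasurable_sum => j; apply: measurable_funeM.
    exact/measurable_EFinP.
  - move=> x _; rewrite indicE; case: (boolP (x \in _)) => [|_]; last first.
      rewrite mule0; apply: sume_ge0 => j _.
      by rewrite mule_ge0// lee_fin ?powR_ge0.
    rewrite inE mule1 => -[vn nv].
    have v0 : (0 < v x)%R by apply: lt_trans nv; rewrite divr_gt0 ?exprn_gt0.
    under eq_bigr do rewrite -EFinM.
    rewrite sumEFin lee_fin.
    apply: le_trans (powR_le_dyadic_sum p0 v0 vn nv) _.
    apply: ler_sum => j _; rewrite ler_wpM2l ?powR_ge0// indicE.
    by case: (boolP (_ < _)%R) => // lv; rewrite mem_set.
rewrite ge0_integral_sum//; first last.
- by move=> j x _; rewrite mule_ge0// lee_fin ?powR_ge0.
- move=> j; apply: measurable_funeM; exact/measurable_EFinP.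
apply: (@le_trans _ _ (\sum_(j < n.*2) \int[chi]_x (c1%:E * (W x * H j x)))).
  apply: lee_sum => j _; rewrite ge0_integralZl_EFin ?powR_ge0//; last first.
    exact/measurable_EFinP.
  by rewrite integral_indic// setIT; exact: level_weight_scaled_le (l0 j).
rewrite -ge0_integral_sum//; first last.
- by move=> j x _; rewrite !mule_ge0// lee_fin.
- by move=> j; apply: measurable_funeM; exact: emeasurable_funM.
rewrite -ge0_integralZl_EFin//; first last.
- apply: emeasurable_funM => //.
  exact: measurableT_comp (measurable_poweR _) mM.
- by move=> x _; rewrite mule_ge0 ?poweR_ge0.
apply: ge0_le_integral => //.
- by move=> x _; apply: sume_ge0 => j _; rewrite !mule_ge0// lee_fin.
- apply: emeasurable_sum => j; apply: measurable_funeM.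
  exact: emeasurable_funM.
- apply: measurable_funeM; apply: emeasurable_funM => //.
  exact: measurableT_comp (measurable_poweR _) mM.
move=> x _.
rewrite -ge0_sume_distrr; last by move=> j _; rewrite mule_ge0.
rewrite -ge0_sume_distrr; last by move=> j _.
rewrite /good_lambda_cst -/c1 [in leRHS]EFinM -[leRHS]muleA.
rewrite lee_wpmul2l ?lee_fin//.
rewrite [leRHS]muleA [leRHS]muleC lee_wpmul2l//.
rewrite sumEFin.
(* The heights [l' j] are the dyadic fractions of this number. *)
have a0 : (0 < 2 ^+ n / (4 * N0) :> R)%R.
  by rewrite divr_gt0 ?exprn_gt0 ?mulr_gt0.
apply: le_trans (dyadic_sum_le_poweR n.*2 q0 a0 (maximal_ge0 mu CC u x)).
rewrite lee_fin; apply: ler_sum => j _.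
have -> : (2 ^+ n / (4 * N0) / 2 ^+ j.+1 = l' j)%R by rewrite /l' /l mulrAC.
rewrite ler_wpM2l ?powR_ge0// indicE.
by case: (boolP (_ \in _)) => [|_]; rewrite ?ler0n// inE /D /= => ->.
Qed.

(** The shells increase to the set where v > 0, and v^p vanishes elsewhere; monotone convergence
    removes the truncation. *)
Lemma weighted_le_maximal_sharp :
  \int[chi]_x (v x `^ p)%:E <=
  good_lambda_cst%:E *
  \int[chi]_x
    (maximal mu CC u x `^ (p - g * beta) * sharp_maximal x `^ (g * beta)).
Proof.
have mvp : measurable_fun [set: T] (fun x => (v x `^ p)%:E).
  by apply/measurable_EFinP; exact: measurableT_comp (measurable_powR p) mv.
have shellE n : (2 ^+ n / 2 ^+ n.*2 = (2 ^+ n)^-1 :> R)%R.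
  by rewrite -addnn exprD invfM mulrA mulfV ?mul1r// expf_neq0.
pose f n x := (v x `^ p)%:E * (\1_(shell n) x)%:E.
have f0 n x : 0 <= f n x by rewrite mule_ge0// lee_fin ?powR_ge0.
have mf n : measurable_fun [set: T] (f n).
  by apply: emeasurable_funM => //; apply/measurable_EFinP.
have ndf x : {homo f ^~ x : n k / (n <= k)%N >-> n <= k}.
  move=> n k nk; rewrite lee_wpmul2l ?lee_fin ?powR_ge0// !indicE ler_nat.
  have nk2 : (2 ^+ n <= 2 ^+ k :> R)%R by rewrite ler_eXn2l ?ltr1n.
  case: (boolP (x \in shell n)) => // /set_mem[vn nv]; rewrite mem_set//.
  split; first exact: le_trans vn nk2.
  apply: le_lt_trans nv; rewrite !shellE lef_pV2 ?posrE ?exprn_gt0//.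
have limf x : limn (f ^~ x) = (v x `^ p)%:E.
  apply: lim_near_cst => //.
  have [v0|v0] := eqVneq (v x) 0%R.
    by apply: nearW => n; rewrite /f v0 powR0 ?gt_eqF// mul0e.
  have {}v0 : (0 < v x)%R by rewrite lt_neqAle eq_sym v0 normr_ge0.
  have bnd (y : R) n : (0 <= y)%R -> (Num.truncn y < n)%N -> (y < 2 ^+ n)%R.
    move=> y0 yn; apply: lt_le_trans (truncnS_gt y) _.
    by rewrite -natrX ler_nat (leq_trans yn)// ltnW// ltn_expl.
  (* From this index on, both v x and its inverse are below 2^n, so [x] is in the shell. *)
  exists (maxn (Num.truncn (v x)) (Num.truncn (v x)^-1)).+1 => // n /=.
  rewrite gtn_max => /andP[vn vn'].
  rewrite /f indicE mem_set ?mule1//; split; first by rewrite ltW// bnd// ltW.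
  by rewrite shellE invf_plt ?posrE ?exprn_gt0// bnd// invr_ge0 ltW.
under eq_integral do rewrite -limf.
rewrite monotone_convergence//; apply: lime_le.
  apply: ereal_nondecreasing_is_cvgn => n k nk.
  by apply: ge0_le_integral => // x _; exact: ndf.
by apply: nearW => n; exact: shell_integral_le.
Qed.

End good_lambda.

(** * Conclusion by Hoelder's inequality *)

Theorem corollary2p10 (R : realType) (N0 Nw p beta gamma : R)
    (hgamma : (0 < gamma <= 1)%R) (hbeta : (0 < beta <= 1)%R)
    (hp : (gamma * beta < p)%R) :
  exists N : R,
  forall (d : measure_display) (T : measurableType d)
    (mu : {sigma_finite_measure set T -> \bar R})
    (LL : set (T -> R)) (CC : int -> set (set T))
    (w : T -> R) (mw : measurable_fun [set: T] w)
    (w0 : forall x, (0 <= w x)%R)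
    (m : int) (u : T -> R),
  let chi : {measure set T -> \bar R} := weight_measure mu mw w0 in
  measure_is_complete mu -> mu [set: T] = +oo ->
  L1dense mu LL ->
  filtration_of_partitions mu CC LL N0 ->
  beta_type mu CC beta Nw chi ->
  L1loc mu u ->
  (forall x, partition_average mu CC (fun y => `|u y|%R) (- k%:Z)%R x
               @[k --> \oo] --> 0) ->
  let I := \int[chi]_x (`| maximal mu CC u x | `^ p) in
  let J := \int[chi]_x
    ((sharp mu CC gamma m u x
      + maximal_le mu CC m (fun y => `|u y| `^ gamma)%R x `^ gamma^-1) `^ p) in
  \int[chi]_x (`|u x| `^ p)%:E
    <= N%:E * I `^ ((p - gamma * beta) / p) * J `^ (gamma * beta / p).
Proof.
case/andP: hgamma => g0 _; case/andP: hbeta => b0 _.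
have gb0 : (0 < gamma * beta)%R by rewrite mulr_gt0.
have p0 : (0 < p)%R by exact: lt_trans gb0 hp.
(* Chosen before the space, the weight and [u], the constant depends on the listed parameters
   only. *)
exists (good_lambda_cst N0 gamma beta Nw p).
move=> d T mu LL CC w mw w0 m u chi _ _ dense fil chib uloc u_to0; cbv zeta.
have meas_u := measurable_L1loc fil uloc.
have chi_ac A : measurable A -> mu A = 0 -> chi A = 0.
  move=> mA muA0; apply: null_set_integral => //.
  exact/measurable_EFinP/measurable_funTS.
apply: le_trans (weighted_le_maximal_sharp fil m meas_u g0 b0 chib dense uloc
  u_to0 chi_ac hp) _.
have cst0 := good_lambda_cst_ge0 fil chib hp.
rewrite -muleA lee_wpmul2l ?lee_fin//.
have mM : measurable_fun [set: T] (fun x => `|maximal mu CC u x| `^ p).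
  apply: measurableT_comp (measurable_poweR p) _.
  by apply: measurableT_comp => //; exact: measurable_maximal fil _.
have mF : measurable_fun [set: T]
    (fun x => sharp_maximal mu CC u gamma m x `^ p).
  apply: measurableT_comp (measurable_poweR p) _.
  exact: measurable_sharp_maximal fil _ _ _.
(* The exponents (p - gamma beta)/p and gamma beta/p sum to 1 and turn the integrands of I and J
   into the two factors. *)
rewrite (eq_integral (fun x =>
  (`|maximal mu CC u x| `^ p) `^ ((p - gamma * beta) / p) *
  (sharp_maximal mu CC u gamma m x `^ p) `^ (gamma * beta / p))); last first.
  move=> x _; rewrite -!poweRrM ![(p * (_ / p))%R]mulrC !divfK ?gt_eqF//.
  by rewrite gee0_abs// maximal_ge0.
apply: hoelder_poweR => //.
- by move=> x; exact: poweR_ge0.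
- by move=> x; exact: poweR_ge0.
- by rewrite divr_gt0// subr_gt0.
- by rewrite divr_gt0.
- by rewrite -mulrDl subrK divff ?gt_eqF.
Qed.
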